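(* Let $\mathcal E$ be the category of partitioned sets and $\mathcal E^{\mathcal D}$ the category of diagrams $A\rightrightarrows X$ in $\mathcal E$. (1) The homotopy equalizer, as defined in the context, gives a functor $\mathcal E^{\mathcal D}\to\mathcal E$ with a natural transformation to the projection functor that takes $A\rightrightarrows X$ to $A$. (2) The homotopy equalizer functor takes a pointwise acyclic map to an acyclic map. (3) Let $f,g:A\rightrightarrows X$ be a diagram in $\mathcal E$. The inclusion $$\{a\in A:f(a)=g(a)\} \hookrightarrow \{a\in A:f(a)\sim g(a)\}$$ of the equalizer into the homotopy equalizer is acyclic if and only if for every $a\in A$ with $f(a)\sim g(a)$, there is $a'\in A$ with $f(a')=g(a')$ such that $a\sim a'$.
   Context: A partitioned set is a set $X$ with an equivalence relation $\sim$. A morphism $f:X\to Y$ of partitioned sets is a map of sets with $f(x)\sim f(x')$ whenever $x\sim x'$. $\mathcal E$ is the category of partitioned sets and their morphisms. A morphism $f:X\to Y$ is acyclic (a weak equivalence) if the induced map of quotient sets $X/\!\sim\;\to Y/\!\sim$ is a bijection. $\mathcal D$ is the category with two objects and two parallel non-identity arrows from the first to the second. Thus an object of $\mathcal E^{\mathcal D}$ is a pair of parallel morphisms $f,g:A\rightrightarrows X$ in $\mathcal E$, and a map from $f,g:A\rightrightarrows X$ to $h,k:B\rightrightarrows Y$ is a pair of morphisms $\alpha:A\to B$, $\beta:X\to Y$ with $h\alpha=\beta f$ and $k\alpha=\beta g$; it is pointwise acyclic if $\alpha$ and $\beta$ are acyclic. The homotopy equalizer of $f,g:A\rightrightarrows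 X$ is the set $\{a\in A:f(a)\sim g(a)\}$ with the equivalence relation induced from $A$. The equalizer in $\mathcal E$ is $\{a\in A:f(a)=g(a)\}$ with the equivalence relation induced from $A$. *)

(* Defs.v *)
From Corelib Require Import RelationClasses.
From mathcomp Require Import all_boot generic_quotient boolp.

Set Implicit Arguments.
Unset Strict Implicit.
Unset Printing Implicit Defensive.

Local Open Scope quotient_scope.

Record category := Category {
  obj :> Type;
  hom : obj -> obj -> Type;
  idm : forall x, hom x x;
  comp : forall x y z, hom y z -> hom x y -> hom x z;
  comp_idl : forall x y (u : hom x y), comp (idm y) u = u;
  comp_idr : forall x y (u : hom x y), comp u (idm x) = u;
  comp_assoc : forall x y z t (w : hom z t) (v : hom y z) (u : hom x y),
    comp w (comp v u) = comp (comp w v) u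
}.
Arguments hom {c} x y : rename.
Arguments idm {c} x : rename.
Arguments comp {c x y z} v u : rename.

(* A functor is indexed by its action on objects, so that "the assignment F0
   is the object part of a functor" can be said without comparing objects. *)
Record functor (C D : category) (F0 : C -> D) := Functor {
  fmap : forall x y : C, hom x y -> hom (F0 x) (F0 y);
  fmap_id : forall x, fmap (idm x) = idm (F0 x);
  fmap_comp : forall x y z (v : hom y z) (u : hom x y),
    fmap (comp v u) = comp (fmap v) (fmap u)
}.
Arguments functor : clear implicits.
Arguments fmap {C D F0} f {x y} u : rename.

Definition natural (C D : category) (F0 G0 : C -> D)
    (F : functor C D F0) (G : functor C D G0) (eta : forall x, hom (F0 x) (G0 x)) :=
  forall (x y : C) (u : hom x y),
    comp (eta y) (fmap F u) = comp (fmap G u) (eta x).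

Record pset := PSet {
  carrier :> Type;
  sim : carrier -> carrier -> Prop;
  sim_equivalence : Equivalence sim
}.
Arguments sim {p} x y : rename.
Notation "x ~= y" := (sim x y) (at level 70, no associativity).

Record pmor (X Y : pset) := PMor {
  pfun :> X -> Y;
  pfun_sim : forall x x' : X, x ~= x' -> pfun x ~= pfun x'
}.

Lemma pmor_ext (X Y : pset) (u v : pmor X Y) : u =1 v -> u = v.
Proof.
case: u v => [u pu] [v pv] /= /funext uv.
by case: _ / uv pv => pv; rewrite (Prop_irrelevance pu pv).
Qed.

Definition pid (X : pset) : pmor X X := @PMor X X id (fun _ _ xx' => xx').

Definition pcomp (X Y Z : pset) (v : pmor Y Z) (u : pmor X Y) : pmor X Z :=
  @PMor X Z (v \o u) (fun _ _ xx' => pfun_sim v (pfun_sim u xx')).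

Definition PSetCat : category.
Proof.
by apply: (@Category pset pmor pid pcomp) => *; apply: pmor_ext.
Defined.

Definition simb (X : pset) : rel {classic X} := fun x y => `[< x ~= y >].

Lemma simb_equiv (X : pset) : equiv_class_of (@simb X).
Proof.
have [simR simS simT] := sim_equivalence X.
split=> [x|x y|y x z]; first exact/asboolP.
  by apply/asboolP/asboolP => /simS.
by move=> /asboolP xy /asboolP yz; apply/asboolP/(simT _ y).
Qed.

Definition simb_equiv_rel (X : pset) := EquivRelPack (simb_equiv X).

Definition pquot (X : pset) := {eq_quot simb_equiv_rel X}.

Definition pclass (X : pset) (x : X) : pquot X := \pi_(pquot X) (x : {classic X}).

Lemma pclassP (X : pset) (x y : X) : pclass x = pclass y <-> x ~= y.
Proof.
by split=> [/(eqmodP (simb_equiv_rel X)) /asboolP|xy] //;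
  apply/(eqmodP (simb_equiv_rel X))/asboolP.
Qed.

Definition pquot_map (X Y : pset) (f : pmor X Y) (q : pquot X) : pquot Y :=
  pclass (f (repr q)).

Lemma pquot_mapE (X Y : pset) (f : pmor X Y) (x : X) :
  pquot_map f (pclass x) = pclass (f x).
Proof. by apply/pclassP/pfun_sim/pclassP; rewrite /pclass reprK. Qed.

Definition acyclic (X Y : pset) (f : pmor X Y) : Prop :=
  bijective (pquot_map f).

(* Functors to partitioned sets from the category with two objects and two
   parallel non-identity arrows between them, written out as parallel pairs;
   [dmap] is the corresponding notion of natural transformation. *)
Record diagram := Diagram {
  dsrc : pset;
  dtgt : pset;
  dfst : pmor dsrc dtgt;
  dsnd : pmor dsrc dtgt
}.

Record dmap (d e : diagram) := DMap {
  msrc : pmor (dsrc d) (dsrc e);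
  mtgt : pmor (dtgt d) (dtgt e);
  dmap_fst : pcomp (dfst e) msrc = pcomp mtgt (dfst d);
  dmap_snd : pcomp (dsnd e) msrc = pcomp mtgt (dsnd d)
}.

Lemma dmap_ext (d e : diagram) (u v : dmap d e) :
  msrc u = msrc v -> mtgt u = mtgt v -> u = v.
Proof.
case: u v => [a b p q] [a' b' p' q'] /= ea eb.
case: _ / ea p' q' => p' q'; case: _ / eb p' q' => p' q'.
by rewrite (Prop_irrelevance p p') (Prop_irrelevance q q').
Qed.

Definition did (d : diagram) : dmap d d.
Proof. by apply: (@DMap d d (pid _) (pid _)); apply: pmor_ext. Defined.

Definition dcomp (d e k : diagram) (v : dmap e k) (u : dmap d e) : dmap d k.
Proof.
apply: (@DMap d k (pcomp (msrc v) (msrc u)) (pcomp (mtgt v) (mtgt u))).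
- apply: pmor_ext => x /=.
  have /= -> := congr1 (fun m : pmor _ _ => m (msrc u x)) (dmap_fst v).
  by have /= -> := congr1 (fun m : pmor _ _ => m x) (dmap_fst u).
- apply: pmor_ext => x /=.
  have /= -> := congr1 (fun m : pmor _ _ => m (msrc u x)) (dmap_snd v).
  by have /= -> := congr1 (fun m : pmor _ _ => m x) (dmap_snd u).
Defined.

Definition DiagramCat : category.
Proof.
by apply: (@Category diagram dmap did dcomp) => *;
  apply: dmap_ext; apply: pmor_ext.
Defined.

Definition pointwise_acyclic (d e : diagram) (u : dmap d e) : Prop :=
  acyclic (msrc u) /\ acyclic (mtgt u).

Definition src_functor : functor DiagramCat PSetCat dsrc :=
  @Functor DiagramCat PSetCat dsrc msrc (fun _ => erefl) (fun _ _ _ _ _ => erefl).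

Lemma sub_sim_equivalence (A : pset) (P : A -> Prop) :
  Equivalence (fun a b : {a : A | P a} => sval a ~= sval b).
Proof.
have [simR simS simT] := sim_equivalence A.
by split=> [a|a b /simS|a b c ab /(simT _ _ _ ab)].
Qed.

Definition sub_pset (A : pset) (P : A -> Prop) : pset :=
  @PSet {a : A | P a} _ (sub_sim_equivalence P).

Definition equalizer (A X : pset) (f g : pmor A X) : pset :=
  sub_pset (fun a : A => f a = g a).

Definition hequalizer (A X : pset) (f g : pmor A X) : pset :=
  sub_pset (fun a : A => f a ~= g a).

Definition hequalizer_incl (A X : pset) (f g : pmor A X) :
    pmor (hequalizer f g) A :=
  @PMor (hequalizer f g) A sval (fun _ _ ab => ab).

Lemma eq_sim (X : pset) (x y : X) : x = y -> x ~= y.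
Proof. by move->; have [simR _ _] := sim_equivalence X; apply: simR. Qed.

Definition equalizer_incl (A X : pset) (f g : pmor A X) :
    pmor (equalizer f g) (hequalizer f g) :=
  @PMor (equalizer f g) (hequalizer f g)
    (fun a => exist _ (sval a) (eq_sim (svalP a))) (fun _ _ ab => ab).

Definition hoeq (d : diagram) : pset := hequalizer (dfst d) (dsnd d).

Definition hoeq_incl (d : diagram) : pmor (hoeq d) (dsrc d) :=
  hequalizer_incl (dfst d) (dsnd d).

(* Main.v *)
From mathcomp Require Import all_boot generic_quotient boolp.
Require Import Defs.

Set Implicit Arguments.
Unset Strict Implicit.
Unset Printing Implicit Defensive.

(** A morphism is acyclic exactly when it reflects [~=] and meets every class ([acyclicP]), so no
    quotient needs to be handled afterwards. Both equalizers carry the relation induced from the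
    source, so reflection is inherited, and only meeting every class takes work. In
    [hoeq_map_acyclic] a point of the target is lifted up to [~=] along [msrc u], and reflection by
    [mtgt u] puts the lift in the homotopy equalizer. In [equalizer_incl_acyclic] meeting every
    class is the stated condition itself. *)

Lemma sim_sym (X : pset) (x y : X) : x ~= y -> y ~= x.
Proof. by have [_ simS _] := sim_equivalence X; apply: simS. Qed.

Lemma sim_trans (X : pset) (y x z : X) : x ~= y -> y ~= z -> x ~= z.
Proof. by have [_ _ simT] := sim_equivalence X; apply: simT. Qed.

Lemma pclass_repr (X : pset) (q : pquot X) : pclass (repr q : X) = q.
Proof. exact: reprK. Qed.

(** The two conditions are injectivity and surjectivity of [pquot_map f], read on
    representatives. *)
Lemma acyclicP (X Y : pset) (f : pmor X Y) :
  acyclic f <->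
  (forall x x' : X, f x ~= f x' -> x ~= x') /\
  (forall y : Y, exists x : X, f x ~= y).
Proof.
split=> [bij_f | [refl_f surj_f]].
  split=> [x x' fxx' | y].
    apply/pclassP/(bij_inj bij_f); rewrite !pquot_mapE; exact/pclassP.
  have [g _ gK] := bij_f; exists (repr (g (pclass y))).
  by apply/pclassP; rewrite -pquot_mapE pclass_repr gK.
have inj_q : injective (pquot_map f).
  move=> p q; rewrite -(pclass_repr p) -(pclass_repr q) !pquot_mapE.
  by move=> /pclassP/refl_f/pclassP.
have surj_q (q : pquot Y) : exists p, pquot_map f p = q.
  have [x fx] := surj_f (repr q); exists (pclass x).
  by rewrite pquot_mapE -[RHS]pclass_repr; apply/pclassP.
(* Choice gives a section of the quotient map; injectivity makes it a two-sided inverse. *)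
have [g gK] := choice surj_q.
by exists g => // p; apply: inj_q; rewrite gK.
Qed.

Lemma dmap_fstE (d e : diagram) (u : dmap d e) (a : dsrc d) :
  dfst e (msrc u a) = mtgt u (dfst d a).
Proof. exact: (congr1 (fun m : pmor _ _ => m a) (dmap_fst u)). Qed.

Lemma dmap_sndE (d e : diagram) (u : dmap d e) (a : dsrc d) :
  dsnd e (msrc u a) = mtgt u (dsnd d a).
Proof. exact: (congr1 (fun m : pmor _ _ => m a) (dmap_snd u)). Qed.

Lemma hoeq_map_subproof (d e : diagram) (u : dmap d e) (a : hoeq d) :
  dfst e (msrc u (sval a)) ~= dsnd e (msrc u (sval a)).
Proof. by rewrite dmap_fstE dmap_sndE; apply/pfun_sim/(svalP a). Qed.

Definition hoeq_map (d e : diagram) (u : dmap d e) : pmor (hoeq d) (hoeq e) :=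
  @PMor (hoeq d) (hoeq e)
    (fun a => exist _ (msrc u (sval a)) (hoeq_map_subproof u a))
    (fun a b => @pfun_sim _ _ (msrc u) (sval a) (sval b)).

Definition hoeq_functor : functor DiagramCat PSetCat hoeq.
Proof.
(* Proof irrelevance reduces the functor laws to equality of underlying points. *)
by apply: (@Functor DiagramCat PSetCat hoeq hoeq_map) => *;
  apply: pmor_ext => -[a fga]; apply: eq_exist.
Defined.

Lemma hoeq_map_acyclic (d e : diagram) (u : dmap d e) :
  pointwise_acyclic u -> acyclic (hoeq_map u).
Proof.
case=> /acyclicP[refl_src surj_src] /acyclicP[refl_tgt _].
apply/acyclicP; split=> [a a' /refl_src // | [b fgb]].
have [a uab] := surj_src b.
have fga : dfst d a ~= dsnd d a.
  apply: refl_tgt; rewrite -dmap_fstE -dmap_sndE.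
  (* With [h], [k] the arrows of [e], the chain is [h (msrc u a) ~= h b ~= k b ~= k (msrc u a)]. *)
  apply: (sim_trans (pfun_sim _ uab)); apply: (sim_trans fgb).
  exact/sim_sym/pfun_sim.
by exists (exist _ a fga).
Qed.

Lemma equalizer_incl_acyclic (A X : pset) (f g : pmor A X) :
  acyclic (equalizer_incl f g) <->
  (forall a : A, f a ~= g a -> exists a' : A, f a' = g a' /\ a ~= a').
Proof.
split=> [/acyclicP[_ surj] a fga | surj].
  by have [[a' fga'] /sim_sym aa'] := surj (exist _ a fga); exists a'.
apply/acyclicP; split=> // -[a fga].
have [a' [fga' /sim_sym aa']] := surj a fga.
by exists (exist _ a' fga').
Qed.

Theorem theorem16 :
  (exists H : functor DiagramCat PSetCat hoeq,
      natural H src_functor hoeq_incl /\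
      (forall (d e : diagram) (u : dmap d e),
          pointwise_acyclic u -> acyclic (fmap H u))) /\
  (forall (A X : pset) (f g : pmor A X),
      acyclic (equalizer_incl f g) <->
      (forall a : A, f a ~= g a -> exists a' : A, f a' = g a' /\ a ~= a')).
Proof.
split; last exact: equalizer_incl_acyclic.
exists hoeq_functor; split; last exact: hoeq_map_acyclic.
(* Both sides of the square send [a] to [msrc u (sval a)] by computation. *)
by move=> d e u; apply: pmor_ext.
Qed.
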